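(* Let $k\ge1$ be an integer, $n=2k$, $\pi=(1,2)(3,4)\cdots(2k-1,2k)\in S_n$, and write $\overline{i}=i^\pi$. Let $P=3^2$ be the elementary abelian group of order 9 with generators $u,v$, and let $\sigma$ be the involutive automorphism of $P$ interchanging $u$ and $v$. Let $\tau$ be the automorphism of the Fischer space of $Wr(P,n)$ given by $$(u^rv^s.(i,j))^\tau=(u^rv^s)^\sigma.(\overline{i},\overline{j})=u^sv^r.(\overline{i},\overline{j}),$$ and let $H=\langle\tau\rangle$. Then the fixed subalgebra $M_H$ of the Matsuo algebra $M=M_\eta(Wr(3^2,n))$ has dimension $9k^2-3k$. Among the $H$-orbit vectors, there are - $3k$ singles $u^rv^s.(2i-1,2i)$, where $0\le r,s\le2$, $r+s\equiv0\pmod 3$ and $1\le i\le k$; - $9k(k-1)$ doubles $t.(i,j)+t^\sigma.(\overline{i},\overline{j})$, where $t\in P$ and $\overline{i}\neq j$; - $3k$ extras $u^rv^s.(2i-1,2i)+u^{2s}v^{2r}.(2i-1,2i)$, where $0\le r,s\le2$, $r+s\not\equiv0\pmod 3$ and $1\le i\le k$.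
   Context: For a group $T$ all of whose elements have order 1, 2 or 3 and an integer $n\ge 2$, let $T\operatorname{wr}S_n=T^n\rtimes S_n$ be the wreath product, with $S_n$ acting naturally on coordinates; for $t\in T$ let $t_i$ be the image of $t$ in the $i$-th factor of $T^n$. The group $Wr(T,n)$ is the subgroup of $T\operatorname{wr}S_n$ generated by the conjugacy class $D$ (in $T\operatorname{wr}S_n$) of a transposition of $S_n$. One has $D=\{t.(i,j)\mid t\in T, 1\le i<j\le n\}$, where $t.(i,j):=t_it_j^{-1}(i,j)$, with $t.(i,j)=t^{-1}.(j,i)$, and $D$ is a class of 3-transpositions: it is a normal generating set of involutions with $|cd|\le3$ for all $c,d\in D$. Here $T=P=3^2$, whose elements are uniquely $u^rv^s$ with $0\le r,s\le 2$. Let $\mathbb{F}$ be a field of characteristic not two and $\eta\in\mathbb{F}\setminus\{0,1\}$. The Matsuo algebra $M_\eta(G,D)$ (also written $M_\eta(G)$) of a 3-transposition group $(G,D)$ is the commutative $\mathbb{F}$-algebra with basis $D$ and product $c\cdot c=c$; $c\cdot d=0$ if $|cd|=2$; $c\cdot d=\frac{\eta}{2}(c+d-c^d)$ if $|cd|=3$. The Fischer space has point set $D$ and lines $\{c,d,c^d\}$ for $c,d\in D$ with $|cd|=3$; its automorphisms act on $M_\eta(G,D)$ by permuting $D$. For a group $H$ of such automorphisms, $M_H=\{u\in M\mid u^h=u\text{ for all }h\in H\}$ is the fixed subalgebra; the orbit vectors $\sum_{c\in O}c$, for $O$ an $H$-orbit on $D$, form a basis of $M_H$. If $H=\langle\tau\rangle$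 with $|\tau|=2$, an orbit vector is a single if it is $a\in D$ with $\{a\}$ an orbit of length 1; a double if it is $a+b$ with $\{a,b\}$ an orbit of length 2 and $a\cdot b=0$; an extra if it is $a+b$ with $\{a,b\}$ an orbit of length 2 and $a\cdot b\neq0$. *)

(* Defs.v *)
From HB Require Import structures.
From mathcomp Require Import all_boot all_order all_fingroup all_algebra
  all_solvable.

Set Implicit Arguments.
Unset Strict Implicit.
Unset Printing Implicit Defensive.

Import GroupScope GRing.Theory.

Section WreathProduct.

Variables (T : finGroupType) (n : nat).

Notation base := {dffun forall _ : 'I_n, T}.

(* t_i is sent to t_(s i), as for the right action i^s of S_n on indices. *)
Definition base_act (f : base) (s : 'S_n) : base := [ffun i => f (s^-1 i)].

Lemma base_act_is_action : is_action [set: 'S_n] base_act.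
Proof.
split=> [s f g /ffunP fg | f s t _ _]; apply/ffunP=> i.
  by have := fg (s i); rewrite !ffunE permK.
by rewrite !ffunE invMg permM.
Qed.

Lemma base_act_is_groupAction :
  is_groupAction [set: base] (Action base_act_is_action).
Proof.
move=> s _; rewrite inE; apply/andP; split.
  by apply/subsetP=> f; rewrite inE.
apply/morphicP=> f g _ _; rewrite !actpermE.
by apply/ffunP=> i; rewrite !ffunE.
Qed.

Definition base_groupAction := GroupAction base_act_is_groupAction.

Definition wr : finGroupType := sdprod_by base_groupAction.

Definition wr_base (f : base) : wr := sdpair1 base_groupAction f.
Definition wr_perm (s : 'S_n) : wr := sdpair2 base_groupAction s.

(* t placed in the i-th factor. *)
Definition ti (i : 'I_n) (t : T) : base := @dfung1 _ (fun=> T) i t.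

(* The element t.(i,j) = t_i t_j^-1 (i,j). *)
Definition tr (t : T) (i j : 'I_n) : wr :=
  wr_base (ti i t * (ti j t)^-1)
    * wr_perm (tperm i j).

(* For n >= 2 this is a single conjugacy class, see wrDE. *)
Definition wrD : {set wr} :=
  class_support [set wr_perm (tperm p.1 p.2) | p : 'I_n * 'I_n & p.1 != p.2]
                [set: wr].

(* The group Wr(T,n); the Matsuo algebra and the Fischer space below only
   refer to its generating class wrD. *)
Definition Wr : {group wr} := <<wrD>>%G.

Lemma wr_baseM f g : wr_base (f * g) = wr_base f * wr_base g.
Proof. by rewrite /wr_base morphM ?inE. Qed.

Lemma wr_permM s t : wr_perm (s * t) = wr_perm s * wr_perm t.
Proof. by rewrite /wr_perm morphM ?inE. Qed.

Lemma wr_baseJ f s : wr_base f ^ wr_perm s = wr_base (base_act f s).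
Proof. by rewrite /wr_base /wr_perm -sdpair_act ?inE. Qed.

Lemma wr_permJ s t : wr_perm s ^ wr_perm t = wr_perm (s ^ t).
Proof. by rewrite /wr_perm morphJ ?inE. Qed.

Lemma wr_baseV f : wr_base f^-1 = (wr_base f)^-1.
Proof. by rewrite /wr_base morphV ?inE. Qed.

Lemma wr_permV s : wr_perm s^-1 = (wr_perm s)^-1.
Proof. by rewrite /wr_perm morphV ?inE. Qed.

Lemma base_mulE (f g : base) i : (f * g) i = f i * g i.
Proof. exact: ffunE. Qed.

Lemma base_invE (f : base) i : f^-1 i = (f i)^-1.
Proof. exact: ffunE. Qed.

Lemma base_actE (f : base) s i : base_act f s i = f (s^-1 i).
Proof. exact: ffunE. Qed.

Lemma tiE i (t : T) j : ti i t j = if i == j then t else 1.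
Proof.
by case: eqP => [<-|/eqP ij]; [apply: dfung1_id | apply: dfung1_dflt].
Qed.

Lemma wr_permJ_base s f :
  wr_perm s ^ wr_base f = wr_base (f^-1 * base_act f s^-1) * wr_perm s.
Proof.
rewrite wr_baseM -wr_baseJ wr_permV wr_baseV !conjgE invgK.
by rewrite !mulgA mulgKV.
Qed.

Lemma tr_conj t i j : i != j ->
  tr t i j = wr_perm (tperm i j) ^ wr_base (ti j t).
Proof.
move=> ij; rewrite wr_permJ_base; congr (wr_base _ * _).
apply/ffunP=> l; rewrite !(base_mulE, base_invE, base_actE, tiE) invgK.
case: tpermP => [->|->|/eqP li /eqP lj].
- by rewrite !eqxx (eq_sym j) (negPf ij) !invg1 mulg1 mul1g.
- by rewrite eqxx (eq_sym j) (negPf ij) mul1g mulg1.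
by rewrite !(eq_sym _ l) (negPf li) (negPf lj) invg1 mulg1.
Qed.

Lemma wrDP x :
  reflect (exists t i j, i != j /\ x = tr t i j) (x \in wrD).
Proof.
apply: (iffP imset2P) => [[y w /imsetP[[i j] ij ->] _ ->] | [t [i [j [ij ->]]]]].
  rewrite inE /= in ij.
  have -> : w = wr_perm w.1 * wr_base w.2 by rewrite -sdpairE.
  set s := w.1; set f := w.2.
  rewrite conjgM wr_permJ tpermJ /=.
  have ij' : s i != s j by rewrite (inj_eq perm_inj).
  move: (s i) (s j) ij' => {ij}i {}j ij.
  exists ((f i)^-1 * f j), i, j; split=> //.
  rewrite wr_permJ_base; congr (wr_base _ * _).
  apply/ffunP=> l; rewrite !(base_mulE, base_invE, base_actE, tiE) invgK.
  case: tpermP => [->|->|/eqP li /eqP lj].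
  - by rewrite !eqxx (eq_sym j) (negPf ij) !invg1 mulg1.
  - by rewrite eqxx (negPf ij) mul1g invMg invgK.
  by rewrite mulVg !(eq_sym _ l) (negPf li) (negPf lj) invg1 mulg1.
exists (wr_perm (tperm i j)) (wr_base (ti j t)) => //.
- by apply/imsetP; exists (i, j); rewrite ?inE.
- by rewrite tr_conj.
Qed.

Lemma mem_tr t i j : i != j -> tr t i j \in wrD.
Proof. by move=> ij; apply/wrDP; exists t, i, j. Qed.

Lemma wrDE i j : i != j -> wrD = wr_perm (tperm i j) ^: [set: wr].
Proof.
move=> ij; apply/setP=> x; apply/imset2P/imsetP => [[y w /imsetP[[k l]]]|].
  rewrite inE /= => kl -> _ ->.
  have [s [<- <-]] : exists s : 'S_n, s i = k /\ s j = l.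
    have kl' : tperm i k j != k.
      by rewrite -{2}(tpermL i k) (inj_eq perm_inj) eq_sym.
    exists (tperm i k * tperm (tperm i k j) l); rewrite !permM tpermL.
    by rewrite tpermL tpermD // eq_sym.
  by exists (wr_perm s * w); rewrite ?inE // conjgM wr_permJ tpermJ.
case=> w _ ->; exists (wr_perm (tperm i j)) w => //.
by apply/imsetP; exists (i, j); rewrite ?inE.
Qed.

End WreathProduct.

Arguments tr {T n} t i j.

Notation point D := {x | x \in D}.

Section FischerSpace.

Variables (gT : finGroupType) (D : {set gT}).

Definition fischer_line (c d : point D) : {set point D} :=
  [set e | val e \in [set val c; val d; val c ^ val d]].

Definition fischer_lines : {set {set point D}} :=
  [set fischer_line c d | c in [set: point D], d in [set: point D]
                        & #[val c * val d] == 3].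

(* The permutations of the points that map lines to lines. *)
Definition fischer_aut : {group {perm point D}} := 'N(fischer_lines | 'P^* )%G.

End FischerSpace.

(* The automorphism tau of the Fischer space exists, for any T and any
   automorphism sigma of T and permutation p of the indices. *)
Section Automorphism.

Variables (T : finGroupType) (n : nat) (sigma : {perm T}) (p : 'S_n).
Hypothesis Aut_sigma : sigma \in Aut [set: T].

Notation base := {dffun forall _ : 'I_n, T}.
Notation wr := (wr T n).

Let phi (f : base) : base := [ffun i => sigma (f (p^-1 i))].

Let Phi (w : wr) : wr := wr_perm T (w.1 ^ p) * wr_base (phi w.2).

Let sigmaM x y : sigma (x * y) = sigma x * sigma y.
Proof. by have /morphicP -> := Aut_morphic Aut_sigma; rewrite ?inE. Qed.

Let sigma1 : sigma 1 = 1.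
Proof. by apply: (mulgI (sigma 1)); rewrite -sigmaM !mulg1. Qed.

Let sigmaV x : sigma x^-1 = (sigma x)^-1.
Proof. by apply: (mulgI (sigma x)); rewrite -sigmaM !mulgV sigma1. Qed.

Let phiM f g : phi (f * g) = phi f * phi g.
Proof. by apply/ffunP=> i; rewrite !ffunE sigmaM. Qed.

Let phi_act f s : phi (base_act f s) = base_act (phi f) (s ^ p).
Proof.
by apply/ffunP=> i; rewrite !ffunE -conjVg conjgE !permM !permK.
Qed.

Let Phi_base f : Phi (wr_base f) = wr_base (phi f).
Proof.
by rewrite /Phi /wr_base /sdpair1 !val_insubd !inE /= conj1g /wr_perm morph1 mul1g.
Qed.

Let Phi_perm s : Phi (wr_perm T s) = wr_perm T (s ^ p).
Proof.
rewrite /Phi /wr_perm /sdpair2 !val_insubd !inE /=.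
have -> : phi 1 = 1 by apply/ffunP=> i; rewrite !ffunE sigma1.
by rewrite /wr_base morph1 mulg1.
Qed.

Let PhiE s f : Phi (wr_perm T s * wr_base f) = wr_perm T (s ^ p) * wr_base (phi f).
Proof.
rewrite /Phi.
have [-> ->] : (wr_perm T s * wr_base f).1 = s /\ (wr_perm T s * wr_base f).2 = f.
  rewrite /wr_perm /wr_base /sdpair1 /sdpair2 /= !val_insubd !inE /=.
  rewrite mulg1; split=> //.
  by apply/ffunP=> i; rewrite !ffunE mul1g.
by [].
Qed.

Let PhiM x y : Phi (x * y) = Phi x * Phi y.
Proof.
have E (w : wr) : w = wr_perm T w.1 * wr_base w.2 by rewrite -sdpairE.
rewrite (E x) (E y) !PhiE; set a := x.1; set b := y.1.
rewrite mulgA -(mulgA (wr_perm T a)) (conjgC (wr_base _) (wr_perm T b)).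
rewrite wr_baseJ mulgA -wr_permM -(mulgA _ (wr_base _)) -wr_baseM PhiE.
rewrite phiM phi_act conjMg wr_permM wr_baseM -wr_baseJ.
rewrite [RHS]mulgA -[in RHS](mulgA (wr_perm T (a ^ p))).
by rewrite (conjgC (wr_base (phi x.2)) (wr_perm T (b ^ p))) !mulgA.
Qed.

Let Phi_inj : injective Phi.
Proof.
have E (w : wr) : w = wr_perm T w.1 * wr_base w.2 by rewrite -sdpairE.
move=> x y; rewrite (E x) (E y) !PhiE.
have J (a b : 'S_n) (f g : base) :
    wr_perm T a * wr_base f = wr_perm T b * wr_base g -> a = b /\ f = g.
  move=> /(congr1 val); rewrite /= !val_insubd !inE /= => -[].
  rewrite !mulg1 => -> /ffunP fg; split=> //; apply/ffunP=> i.
  by have := fg i; rewrite !ffunE !mul1g.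
move=> /J[/conjg_inj -> /ffunP fg]; congr (_ * wr_base _).
by apply/ffunP=> i; have := fg (p i); rewrite !ffunE !permK => /perm_inj.
Qed.

Let Phi_tr t i j : Phi (tr t i j) = tr (sigma t) (p i) (p j).
Proof.
rewrite /tr PhiM Phi_base Phi_perm tpermJ; congr (wr_base _ * _).
apply/ffunP=> l; rewrite ffunE !(base_mulE, base_invE, tiE) sigmaM sigmaV.
rewrite -[in RHS](permKV p l) !(inj_eq perm_inj).
by do 2 case: eqP => _; rewrite ?sigma1.
Qed.

Let Phi_D (c : point (wrD T n)) : Phi (val c) \in wrD T n.
Proof.
have /wrDP[t [i [j [ij ->]]]] := valP c.
by rewrite Phi_tr mem_tr // (inj_eq perm_inj).
Qed.

Lemma wr_fischer_aut_exists : exists2 tau : {perm point (wrD T n)},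
  tau \in fischer_aut (wrD T n) &
  forall (c : point (wrD T n)) t i j,
    i != j -> val c = tr t i j -> val (tau c) = tr (sigma t) (p i) (p j).
Proof.
pose f (c : point (wrD T n)) : point (wrD T n) :=
  Sub (Phi (val c)) (Phi_D c).
have f_inj : injective f.
  by move=> c d /(congr1 val) /= /Phi_inj /val_inj.
have Phi1 : Phi 1 = 1 by apply: (mulgI (Phi 1)); rewrite -PhiM !mulg1.
have PhiX x m : Phi (x ^+ m) = Phi x ^+ m.
  by elim: m => [|m IH]; rewrite ?expg0 // !expgS PhiM IH.
have PhiV x : Phi x^-1 = (Phi x)^-1.
  by apply: (mulgI (Phi x)); rewrite -PhiM !mulgV.
have Phi_order x : #[Phi x] = #[x].
  apply/eqP; rewrite eqn_dvd !order_dvdn -PhiX expg_order Phi1 eqxx /=.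
  by rewrite -(inj_eq Phi_inj) PhiX expg_order Phi1.
exists (perm f_inj) => [|c t i j _ ce]; last by rewrite permE /= ce Phi_tr.
rewrite !inE /=; apply/subsetP=> _ /imset2P[c d _ ocd ->]; rewrite inE.
rewrite !inE /= in ocd.
apply/imset2P; exists (f c) (f d) => //; first by rewrite !inE /= -PhiM Phi_order.
apply/setP=> e; apply/imsetP/idP => [[e' le' ->]|le].
  move: le'; rewrite /= /aperm permE !inE /=.
  case/orP=> [/orP[]|] /eqP ->; rewrite ?eqxx ?orbT //.
  by rewrite !conjgE !PhiM PhiV eqxx orbT.
have fK := permKV (perm f_inj) e; exists ((perm f_inj)^-1 e); last by rewrite -[LHS]fK.
move: le; rewrite -{1}fK permE !inE /=.
have -> : Phi (val c) ^ Phi (val d) = Phi (val c ^ val d).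
  by rewrite !conjgE !PhiM PhiV.
by rewrite !(inj_eq Phi_inj).
Qed.

End Automorphism.

Local Open Scope ring_scope.

(* The underlying space of the Matsuo algebra: the coordinates of a vector on
   the basis D. *)
Notation matsuo F D := {ffun point D -> F^o}.

Section Matsuo.

Variables (F : fieldType) (eta : F) (gT : finGroupType) (D : {set gT}).

(* The basis vector x, for x in D. *)
Definition mvec (x : gT) : matsuo F D := [ffun e => (val e == x)%:R].

(* In a class of 3-transpositions the last case is that of order 2. *)
Definition mvec_mul (c d : gT) : matsuo F D :=
  if c == d then mvec c
  else if #[(c * d)%g] == 3%N then
    (eta / 2%:R) *: (mvec c + mvec d - mvec (c ^ d)%g)
  else 0.

Definition matsuo_mul (x y : matsuo F D) : matsuo F D :=
  \sum_(c : point D) \sum_(d : point D)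
    (x c * y d : F) *: mvec_mul (val c) (val d).

Definition matsuo_act (h : {perm point D}) (x : matsuo F D) : matsuo F D :=
  \sum_(c : point D) (x c : F) *: mvec (val (h c)).

Fact matsuo_act_is_linear h : linear (matsuo_act h).
Proof.
move=> a x y; rewrite /matsuo_act scaler_sumr -big_split /=.
by apply: eq_bigr => c _; rewrite !ffunE scalerA -scalerDl.
Qed.

HB.instance Definition _ h :=
  GRing.isLinear.Build F (matsuo F D) (matsuo F D) _ (matsuo_act h)
    (matsuo_act_is_linear h).

Section Fixed.

Variable H : {group {perm point D}}.

Definition matsuo_fixed : {vspace matsuo F D} :=
  (\bigcap_(h in H) fixedSpace (linfun (matsuo_act h)))%VS.

Lemma matsuo_fixedP x :
  reflect (forall h, h \in H -> matsuo_act h x = x) (x \in matsuo_fixed).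
Proof.
apply: (iffP subv_bigcapP) => [fx h Hh | fx h Hh].
  by have /fixedSpaceP := fx h Hh; rewrite lfunE.
by apply/fixedSpaceP; rewrite lfunE; apply: fx.
Qed.

Definition orbits : {set {set point D}} := [set orbit 'P H c | c : point D].

Definition orbit_vector (A : {set point D}) : matsuo F D :=
  \sum_(c in A) mvec (val c).

Definition orbit_vectors : seq (matsuo F D) :=
  [seq orbit_vector A | A in orbits].

Definition is_single (w : matsuo F D) : bool :=
  (w \in orbit_vectors) &&
  [exists a : point D, ([set a] \in orbits) && (w == mvec (val a))].

Definition is_double (w : matsuo F D) : bool :=
  (w \in orbit_vectors) &&
  [exists a : point D, exists b : point D,
    [&& a != b, [set a; b] \in orbits, w == mvec (val a) + mvec (val b)
      & matsuo_mul (mvec (val a)) (mvec (val b)) == 0]].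

Definition is_extra (w : matsuo F D) : bool :=
  (w \in orbit_vectors) &&
  [exists a : point D, exists b : point D,
    [&& a != b, [set a; b] \in orbits, w == mvec (val a) + mvec (val b)
      & matsuo_mul (mvec (val a)) (mvec (val b)) != 0]].

End Fixed.

End Matsuo.

(* The predicate p holds for exactly m elements of V. *)
Definition has_card (V : eqType) (p : pred V) (m : nat) : Prop :=
  exists s : seq V, [/\ uniq s, s =i p & size s = m].

(* With indices starting at 0, lo i and hi i play the role of 2i-1 and 2i. *)
Section Pairs.

Variable k : nat.

Fact lo_proof (i : 'I_k) : (2 * i < 2 * k)%N.
Proof. by rewrite ltn_mul2l /=. Qed.

Fact hi_proof (i : 'I_k) : ((2 * i).+1 < 2 * k)%N.
Proof. by rewrite -[leqLHS]/((2 * i).+2) -(addn2 (2 * i)) -mulnSr leq_mul2l /=. Qed.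

Definition lo (i : 'I_k) : 'I_(2 * k) := Ordinal (lo_proof i).
Definition hi (i : 'I_k) : 'I_(2 * k) := Ordinal (hi_proof i).

Definition pi_pairs : 'S_(2 * k) := (\prod_(i < k) tperm (lo i) (hi i))%g.

End Pairs.

(* Main.v *)
Require Import Defs.
From mathcomp Require Import all_boot all_order all_fingroup all_algebra all_solvable.
From mathcomp Require Import zify.

(** The orbit vectors form a basis of the fixed subalgebra, so its dimension is
    the number of orbits (dim_matsuo_fixed). Since tau is an involution, an
    orbit is some {c, tau c}, and everything reduces to comparing c with tau c
    for c = t.(i,j). Two expressions t.(i,j) name the same point only if they
    agree or differ by the swap t.(i,j) = t^-1.(j,i) (tr_eq); this settles all
    comparisons.

    If j is the partner of i under pi, then c = t.(lo a,hi a) is sent to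
    (sigma t)^-1.(lo a,hi a). It is fixed exactly when sigma inverts t; otherwise
    c and tau c are distinct points over the same transposition, their product
    has order 3, and the orbit is an extra (mvec_mul_lo_hi). If j is not the
    partner of i, then (i,j) and (pi i,pi j) are disjoint, c and tau c are
    distinct, their product does not have order 3, and the orbit is a double
    (mvec_mul_tau). This part holds for every group T of exponent dividing 3
    with an involutive sigma.

    The counts come from parametrising each kind of orbit injectively. Doubles
    correspond to an element of T and an ordered pair of distinct blocks
    (tau_sum_partner, tau_sum_partner_inj), which gives 9 k (k - 1). For
    t = u^r v^s one has (sigma t)^-1 = u^(2s) v^(2r), so t |-> (sigma t)^-1
    negates the weight r + s modulo 3: it fixes the three elements of weight 0,
    and pairs those of weight 1 with those of weight 2. Hence 3 singles and 3
    extras in each of the k blocks. The total is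
    3 k + 9 k (k - 1) + 3 k = 9 k^2 - 3 k. *)

Set Implicit Arguments.
Unset Strict Implicit.
Unset Printing Implicit Defensive.

Import GroupScope GRing.Theory.
Local Open Scope ring_scope.

(** * Cardinals of predicates *)

Section HasCard.

Variable V : eqType.
Implicit Types p q : pred V.

Lemma has_card_image (I : finType) (f : I -> V) p :
  injective f -> (forall w, p w <-> exists i, w = f i) -> has_card p #|I|.
Proof.
move=> f_inj pE; exists (codom f); split=> [|w|]; last by rewrite size_codom.
  by rewrite map_inj_uniq ?enum_uniq.
apply/codomP/idP => [[i ->]|]; rewrite unfold_in.
  by apply/pE; exists i.
by move/pE.
Qed.

Lemma has_card_inj p m n : has_card p m -> has_card p n -> m = n.
Proof.
case=> s [us sp <-] [t [ut tp <-]]; apply/perm_size/uniq_perm=> // w.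
by rewrite sp tp.
Qed.

Lemma has_card_predU p q m n :
    has_card p m -> has_card q n -> (forall w, p w -> q w -> False) ->
  has_card (predU p q) (m + n).
Proof.
case=> s [us sp <-] [t [ut tq <-]] pq; exists (s ++ t); split.
- rewrite cat_uniq us ut andbT /=; apply/hasPn => w; rewrite tq sp => qw.
  by apply/negP => /pq; apply.
- by move=> w; rewrite mem_cat sp tq.
by rewrite size_cat.
Qed.

Lemma eq_has_card p q m : p =1 q -> has_card p m -> has_card q m.
Proof.
move=> pq [s [us sp sz]]; exists s; split=> // w.
by rewrite sp !unfold_in pq.
Qed.

End HasCard.

(** * The basis vectors of the Matsuo algebra *)

Section MatsuoBasis.

Variables (F : fieldType) (gT : finGroupType) (D : {set gT}).
Implicit Types (A B : {set point D}) (c d e : point D) (x : matsuo F D).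

Lemma mvecE c e : mvec F D (val c) e = (e == c)%:R.
Proof. by rewrite ffunE. Qed.

Lemma orbit_vectorE A e : orbit_vector F A e = (e \in A)%:R.
Proof.
rewrite sum_ffunE; case: (boolP (e \in A)) => eA.
  rewrite (bigD1 e) //= mvecE eqxx big1 ?addr0 // => c /andP[_ /negPf ce].
  by rewrite mvecE eq_sym ce.
rewrite big1 // => c cA; rewrite mvecE; case: eqP => // ec.
by rewrite ec cA in eA.
Qed.

Lemma orbit_vector_inj : injective (@orbit_vector F gT D).
Proof.
move=> A B /ffunP AB; apply/setP=> e; have := AB e; rewrite !orbit_vectorE.
by do 2 case: (e \in _) => //; move/eqP; rewrite ?oner_eq0 // eq_sym oner_eq0.
Qed.

Lemma orbit_vector1 c : orbit_vector F [set c] = mvec F D (val c).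
Proof. by rewrite /orbit_vector big_set1. Qed.

Lemma orbit_vector2 c d : c != d ->
  orbit_vector F [set c; d] = mvec F D (val c) + mvec F D (val d).
Proof. by move=> cd; rewrite /orbit_vector big_setU1 ?inE // big_set1. Qed.

Lemma matsuo_actE h x c : matsuo_act h x (h c) = x c.
Proof.
rewrite sum_ffunE (bigD1 c) //= ffunE mvecE eqxx -[_ *: _]/(_ * _) mulr1.
rewrite big1 ?addr0 // => d /negPf dc.
by rewrite ffunE mvecE (inj_eq perm_inj) eq_sym dc -[_ *: _]/(_ * _) mulr0.
Qed.

Lemma matsuo_mul_mvec (eta : F) c d :
  matsuo_mul eta (mvec F D (val c)) (mvec F D (val d))
  = mvec_mul eta D (val c) (val d).
Proof.
rewrite /matsuo_mul (bigD1 c) //= (bigD1 d) //= !mvecE !eqxx mulr1 scale1r.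
rewrite big1 => [|e /negPf ed]; last by rewrite !mvecE ed mulr0 scale0r.
rewrite addr0 big1 ?addr0 // => e /negPf ec.
by apply: big1 => f _; rewrite mvecE ec mul0r scale0r.
Qed.

End MatsuoBasis.

(** * Dimension of the fixed subspace *)

Section FixedDimension.

Variables (F : fieldType) (gT : finGroupType) (D : {set gT}).
Variable H : {group {perm point D}}.
Implicit Types (c d e : point D) (x : matsuo F D).

Lemma matsuo_fixed_orbitP x :
  reflect (forall c d, d \in orbit 'P H c -> x d = x c) (x \in matsuo_fixed F H).
Proof.
apply: (iffP (matsuo_fixedP _ _)) => [fx c _ /imsetP[h Hh ->] | fx h Hh].
  by rewrite -{1}(fx h Hh) /= /aperm matsuo_actE.
apply/ffunP=> e; rewrite -[e](permKV h) matsuo_actE.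
by apply: fx; rewrite orbit_sym; apply: (mem_orbit 'P _ Hh).
Qed.

Lemma mem_orbits A c : A \in orbits H -> (c \in A) = (A == orbit 'P H c).
Proof.
case/imsetP=> d _ ->; rewrite [RHS]eq_sym.
by apply/orbit_eqP/eqP.
Qed.

(** A fixed vector is constant on orbits, and orbit vectors have disjoint
    supports: they span the fixed vectors, and evaluating a linear relation at
    one point of each orbit shows that they are independent. *)
Lemma dim_matsuo_fixed : \dim (matsuo_fixed F H) = #|orbits H|.
Proof.
pose O (i : 'I_#|orbits H|) := enum_val i.
have O_orb i : O i \in orbits H by apply: enum_valP.
have O_ex c : exists i, O i = orbit 'P H c.
  have cH : orbit 'P H c \in orbits H by apply: imset_f.
  by exists (enum_rank_in cH (orbit 'P H c)); rewrite /O enum_rankK_in.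
pose X := [tuple orbit_vector F (O i) | i < #|orbits H|].
have Xi (i : 'I_#|orbits H|) : X`_i = orbit_vector F (O i) by rewrite -tnth_nth tnth_mktuple.
have XE (a : 'I_#|orbits H| -> F) i c :
    O i = orbit 'P H c -> (\sum_(j < #|orbits H|) a j *: X`_j) c = a i.
  move=> Oi; rewrite sum_ffunE (bigD1 i) //= ffunE Xi orbit_vectorE mem_orbits // Oi eqxx -[_ *: _]/(_ * _) mulr1.
  rewrite big1 ?addr0 // => j ji; rewrite ffunE Xi orbit_vectorE mem_orbits // -Oi (inj_eq enum_val_inj) (negPf ji).
  by rewrite -[_ *: _]/(_ * _) mulr0.
apply: (@size_basis _ _ _ _ X); apply/andP; split; last first.
  apply/freeP=> a a0 i; have /imsetP[c _ Oi] := O_orb i.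
  by rewrite -(XE a i c Oi) a0 ffunE.
rewrite eqEsubv; apply/andP; split.
  apply/span_subvP=> _ /mapP[i _ ->]; apply/matsuo_fixed_orbitP=> c d dc.
  by rewrite !orbit_vectorE !mem_orbits // (orbit_eqP dc).
apply/subvP=> x /matsuo_fixed_orbitP fx.
(* The coefficient of an orbit is the value at any of its points; the default 0
   is never reached, an orbit being nonempty. *)
have -> : x = \sum_(i < #|orbits H|) (if [pick c in O i] is Some c then x c else 0) *: X`_i.
  apply/ffunP=> e; have [i Oi] := O_ex e; rewrite (XE _ i e Oi).
  case: pickP => [c|/(_ e)]; rewrite Oi; last by rewrite orbit_refl.
  by move/fx.
by apply: memv_suml => i _; apply/memvZ/memv_span/mem_nth; rewrite size_tuple.
Qed.

Lemma has_card_orbit_vectors :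
  has_card [pred w | w \in orbit_vectors F H] #|orbits H|.
Proof.
exists (orbit_vectors F H); split=> //; last by rewrite size_map cardE.
by rewrite map_inj_uniq ?enum_uniq //; apply: orbit_vector_inj.
Qed.

End FixedDimension.

(** * Orbits of an involution *)

Section Involution.

Variables (F : fieldType) (eta : F) (gT : finGroupType) (D : {set gT}).
Variable tau : {perm point D}.
Hypothesis tauK : involutive tau.
Notation H := <[tau]>%G.
Notation vec := (mvec F D).
Implicit Types (c d e : point D) (w : matsuo F D).

Lemma orbit_involution c : orbit 'P H c = [set c; tau c].
Proof.
apply/setP=> d; apply/idP/set2P => [|[]->].
- case/imsetP=> _ /cycleP[n ->] ->; rewrite /= /aperm.
  by elim: n => [|n IH]; [left; rewrite perm1 | rewrite expgSr permM;
     case: IH => ->; [right | left; rewrite tauK]].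
- exact: orbit_refl.
exact: (mem_orbit 'P _ (cycle_id tau)).
Qed.

Lemma orbits_involutionP (A : {set point D}) :
  reflect (exists c, A = [set c; tau c]) (A \in orbits H).
Proof.
apply: (iffP imsetP) => [[c _ ->]|[c ->]]; exists c => //;
  by rewrite orbit_involution.
Qed.

Lemma mem_orbit_vector (A : {set point D}) :
  A \in orbits H -> orbit_vector F A \in orbit_vectors F H.
Proof. by move=> AH; apply: map_f; rewrite mem_enum. Qed.

Lemma is_singleP w :
  reflect (exists2 c, tau c = c & w = vec (val c)) (@is_single F _ D H w).
Proof.
apply: (iffP andP) => [[_ /existsP[a /andP[/orbits_involutionP[c ac] /eqP ->]]] |].
  exists a => //.
  have /set1P ca : c \in [set a] by rewrite ac set21.
  have /set1P : tau c \in [set a] by rewrite ac set22.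
  by rewrite ca.
case=> c fc ->.
have cH : [set c] \in orbits H.
  by apply/orbits_involutionP; exists c; rewrite fc setUid.
by rewrite -orbit_vector1 mem_orbit_vector //; split=> //; apply/existsP;
   exists c; rewrite cH orbit_vector1 eqxx.
Qed.

Lemma orbit_pair c d : c != d -> [set c; d] \in orbits H -> d = tau c.
Proof.
move=> cd cdH.
have : d \in [set c; d] by rewrite set22.
have : c \in [set c; d] by rewrite set21.
rewrite (mem_orbits c cdH) => /eqP ->.
by rewrite orbit_involution => /set2P[dc|//]; rewrite dc eqxx in cd.
Qed.

(** Doubles and extras differ only in the condition p on the two points of the
    orbit. The point c is whichever of the two is taken as a. *)
Lemma pair_orbitP w (p : rel (point D)) :
  reflect (exists c, [/\ tau c != c, p c (tau c) & w = vec (val c) + vec (val (tau c))])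
   ((w \in orbit_vectors F H) && [exists a : point D, exists b : point D,
      [&& a != b, [set a; b] \in orbits H, w == vec (val a) + vec (val b) & p a b]]).
Proof.
apply: (iffP andP).
  case=> _ /existsP[a /existsP[b /and4P[ab abH /eqP -> pab]]].
  have bE := orbit_pair ab abH; exists a.
  by rewrite -bE eq_sym.
case=> c [fc pc ->]; rewrite eq_sym in fc.
have cH : [set c; tau c] \in orbits H by apply/orbits_involutionP; exists c.
rewrite -orbit_vector2 // mem_orbit_vector //; split=> //.
by apply/existsP; exists c; apply/existsP; exists (tau c);
  rewrite fc cH orbit_vector2 // eqxx.
Qed.

Lemma is_doubleP w :
  reflect (exists c, [/\ tau c != c, mvec_mul eta D (val c) (val (tau c)) = 0
                     & w = vec (val c) + vec (val (tau c))])
    (@is_double F eta _ D H w).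
Proof.
apply: (iffP (pair_orbitP w
  (fun a b => matsuo_mul eta (vec (val a)) (vec (val b)) == 0))) => -[c].
  by rewrite matsuo_mul_mvec => -[fc /eqP]; exists c.
by case=> fc /eqP; rewrite -matsuo_mul_mvec; exists c.
Qed.

Lemma is_extraP w :
  reflect (exists c, [/\ tau c != c, mvec_mul eta D (val c) (val (tau c)) != 0
                     & w = vec (val c) + vec (val (tau c))])
    (@is_extra F eta _ D H w).
Proof.
apply: (iffP (pair_orbitP w
  (fun a b => matsuo_mul eta (vec (val a)) (vec (val b)) != 0))) => -[c].
  by rewrite matsuo_mul_mvec; exists c.
by rewrite -matsuo_mul_mvec; exists c.
Qed.

Lemma orbit_vectors_cases w :
  (w \in orbit_vectors F H) =
  [|| @is_single F _ D H w, @is_double F eta _ D H w | @is_extra F eta _ D H w].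
Proof.
apply/idP/or3P => [|[] /andP[] //].
case/mapP=> A; rewrite mem_enum => /orbits_involutionP[c ->] ->.
have [fc|fc] := eqVneq (tau c) c.
  by constructor 1; apply/is_singleP; exists c; rewrite // fc setUid orbit_vector1.
rewrite orbit_vector2 1?eq_sym //.
have [m0|m0] := eqVneq (mvec_mul eta D (val c) (val (tau c))) 0.
  by constructor 2; apply/is_doubleP; exists c.
by constructor 3; apply/is_extraP; exists c.
Qed.

End Involution.

(** * The class of reflections of the wreath product *)

Section Reflections.

Variables (T : finGroupType) (n : nat).
Implicit Types (s t : T) (i j : 'I_n).
Notation base := {dffun forall _ : 'I_n, T}.

Lemma wr_normal_inj (f g : base) (s t : 'S_n) :
  (wr_base f * wr_perm T s = wr_base g * wr_perm T t)%g -> f = g /\ s = t.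
Proof.
move/(congr1 val); rewrite /= !val_insubd !inE /= => -[].
rewrite !mul1g => -> /ffunP fg; split=> //; apply/ffunP=> i.
by have := fg (t i); rewrite !ffunE !mulg1 !permK.
Qed.

Lemma tr_swap t i j : i != j -> tr t i j = tr t^-1%g j i.
Proof.
move=> ij; rewrite /tr tpermC; congr (wr_base _ * _)%g; apply/ffunP=> l.
rewrite !(base_mulE, base_invE, tiE); case: eqP => [<-|_].
  by rewrite eq_sym (negPf ij) invg1 invgK mul1g mulg1.
by case: eqP; rewrite ?invg1 mul1g ?invg1 ?mulg1.
Qed.

(** The permutation part determines the pair of indices up to order, and the
    value of the base part at the first index is the label. *)
Lemma tr_eq s t i j i' j' : i != j -> i' != j' -> tr s i j = tr t i' j' ->
  [/\ i = i', j = j' & s = t] \/ [/\ i = j', j = i' & s = t^-1%g].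
Proof.
have inj s' t' (k l : 'I_n) : k != l -> tr s' k l = tr t' k l -> s' = t'.
  move=> kl /wr_normal_inj[] /ffunP/(_ k); rewrite !(base_mulE, base_invE, tiE).
  by rewrite eqxx eq_sym (negPf kl) invg1 !mulg1.
move=> ij ij' e; have [_ st] := wr_normal_inj e.
have := congr1 (fun p : 'S_n => p i) st; rewrite tpermL.
case: tpermP => [ii|ii|_ _ ji].
- move=> jj; left; split=> //; apply: (inj _ _ i j) => //.
  by rewrite e ii jj.
- move=> jj; right; split=> //; apply: (inj _ _ i j) => //.
  by rewrite e (tr_swap _ ij') ii jj.
by rewrite ji eqxx in ij.
Qed.

Lemma tr_mul s t i j : i != j ->
  (tr s i j * tr t i j = wr_base (ti i (s * t^-1) * ti j (s^-1 * t)))%g.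
Proof.
move=> ij; rewrite /tr -!mulgA (mulgA (wr_perm _ _)) (conjgCV (wr_perm _ _)).
rewrite -mulgA -wr_permM tperm2 -wr_permV wr_baseJ /wr_perm morph1 mulg1 -wr_baseM.
congr wr_base; apply/ffunP=> l.
rewrite !(base_mulE, base_invE, base_actE, tiE) !tpermV.
case: tpermP => [->|->|/eqP li /eqP lj].
- by rewrite !eqxx (eq_sym j) (negPf ij) invg1 !mulg1 mul1g.
- by rewrite !eqxx (eq_sym j) (negPf ij) invg1 !mulg1 !mul1g.
by rewrite !(eq_sym _ l) (negPf li) (negPf lj) invg1 !mulg1.
Qed.

Lemma tr_involution t i j : i != j -> (tr t i j * tr t i j)%g = 1%g.
Proof.
move=> ij; rewrite tr_mul // mulgV mulVg /wr_base.
have -> : (ti i (1 : T) * ti j 1)%g = 1%g.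
  by apply/ffunP=> l; rewrite base_mulE !tiE !if_same mulg1 ffunE.
by rewrite morph1.
Qed.

(** The product lies in the base group, where the cube is trivial;
    it is 1 only for s = t, as t.(i,j) is an involution. *)
Lemma order_tr_mul s t i j : (forall x : T, x ^+ 3 = 1)%g -> i != j -> s != t ->
  #[(tr s i j * tr t i j)%g] = 3%N.
Proof.
move=> T3 ij st; apply: nt_prime_order => //.
  rewrite tr_mul // !expgS expg0 mulg1 -!wr_baseM -(morph1 (sdpair1_morphism _)).
  congr wr_base; apply/ffunP=> l.
  have -> : (1%g : base) l = 1%g by rewrite ffunE.
  have := T3 ((ti i (s * t^-1) * ti j (s^-1 * t))%g l).
  by rewrite !expgS expg0 mulg1 -!base_mulE.
apply: contra st; rewrite -(tr_involution t ij) => /eqP/mulIg.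
by case/(tr_eq ij ij) => -[ji _ st]; [rewrite st | rewrite ji eqxx in ij].
Qed.

(** The two reflections commute in fact, but it is enough to see that the cube
    of the product still moves i, through its permutation part. *)
Lemma order_tr_disjoint s t i j i' j' :
    i != j -> i' != j' -> i != i' -> i != j' -> j != i' -> j != j' ->
  #[(tr s i j * tr t i' j')%g] != 3%N.
Proof.
move=> ij ij' ii ij1 ji jj; apply/negP=> /eqP o3.
have := expg_order (tr s i j * tr t i' j')%g; rewrite o3 => /(congr1 val) /=.
move/(congr1 fst)/permP/(_ i); rewrite /= !val_insubd !inE /=.
rewrite !(mul1g, mulg1, permM, perm1) !(tpermL, tpermR).
have Di : tperm i' j' i = i by rewrite tpermD // eq_sym.
have Dj : tperm i' j' j = j by rewrite tpermD // eq_sym.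
by rewrite Dj tpermR Di tpermL Dj => e; rewrite e eqxx in ij.
Qed.

End Reflections.

(** * Products and sums of basis vectors *)

Section MatsuoProducts.

Variables (F : fieldType) (eta : F) (gT : finGroupType) (D : {set gT}).

(** The coordinate of the product at c is eta / 2 unless c ^ d = c; but then c
    and d would be commuting involutions, and c * d would not have order 3. *)
Lemma mvec_mul_neq0 (c : point D) (d : gT) :
    2%:R != 0 :> F -> eta != 0 ->
    (val c * val c = 1)%g -> (d * d = 1)%g -> #[(val c * d)%g] = 3%N ->
  mvec_mul eta D (val c) d != 0.
Proof.
move=> F2 eta0 cc dd o3; rewrite /mvec_mul o3 eqxx.
have cdE : (val c == d) = false.
  by apply/eqP=> cd; rewrite -cd cc order1 in o3.
have cJE : (val c == val c ^ d)%g = false.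
  apply/eqP=> /esym/conjg_fixP/commgP cd.
  have := expg_order (val c * d)%g; rewrite o3 expgMn // !expgS expg0 !mulg1.
  by rewrite cc dd !mulg1 => cd1; rewrite cd1 order1 in o3.
rewrite cdE; apply/eqP=> /ffunP/(_ c); rewrite !ffunE eqxx cdE cJE.
rewrite addr0 subr0 => /eqP.
by rewrite -[_ *: _]/(_ * _) mulr1 mulf_eq0 invr_eq0 (negPf eta0) (negPf F2).
Qed.

Lemma mvec_mul_eq0 (c d : gT) : c != d -> #[(c * d)%g] != 3%N ->
  mvec_mul eta D c d = 0.
Proof. by rewrite /mvec_mul => /negPf -> /negPf ->. Qed.

Lemma mvec_inj (x y : gT) : x \in D -> mvec F D x = mvec F D y -> x = y.
Proof.
move=> Dx /ffunP/(_ (Sub x Dx)); rewrite !ffunE /= eqxx.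
by case: eqP => // _ /eqP; rewrite oner_eq0.
Qed.

Lemma mvec_pair_inj (x y x' y' : gT) : x \in D -> x != y ->
  mvec F D x + mvec F D y = mvec F D x' + mvec F D y' -> x = x' \/ x = y'.
Proof.
move=> Dx /negPf xy /ffunP/(_ (Sub x Dx)); rewrite !ffunE /= eqxx xy addr0.
case: eqP => [|_]; first by left.
case: eqP => [|_]; first by right.
by move/eqP; rewrite add0r oner_eq0.
Qed.

Lemma mvec_neq_pair (x y z : gT) : x \in D -> y \in D -> x != y ->
  mvec F D x + mvec F D y != mvec F D z.
Proof.
move=> Dx Dy xy; apply/eqP=> /ffunP e; case/eqP: (xy).
have -> : x = z.
  have := e (Sub x Dx); rewrite !ffunE /= eqxx (negPf xy) addr0.
  by case: eqP => // _ /eqP; rewrite oner_eq0.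
have := e (Sub y Dy); rewrite !ffunE /= eqxx eq_sym (negPf xy) add0r.
by case: eqP => // _ /eqP; rewrite oner_eq0.
Qed.

End MatsuoProducts.

(** * The pairing of the indices *)

Section PairsOfIndices.

Variable k : nat.
Implicit Types (a b : 'I_k) (i j : 'I_(2 * k)).

Lemma lo_inj : injective (@lo k).
Proof. by move=> a b /(congr1 val) /= /eqP; rewrite eqn_mul2l /= => /eqP/val_inj. Qed.

Lemma hi_inj : injective (@hi k).
Proof. by move=> a b [] /eqP; rewrite eqn_mul2l /= => /eqP/val_inj. Qed.

Lemma lo_neq_hi a b : lo a != hi b.
Proof.
by apply/eqP=> /(congr1 val)/(congr1 odd); rewrite /= !oddM.
Qed.

Lemma lo_hi_cases i : exists a, i = lo a \/ i = hi a.
Proof.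
have ik : (i./2 < k)%N.
  by rewrite ltn_half_double -mul2n.
exists (Ordinal ik); case o: (odd i); [right | left]; apply: val_inj;
  by rewrite -[LHS]odd_double_half o -mul2n.
Qed.

(** Induction over the factors needs both images at once, and also the indices
    whose block is not in r, which are not moved. *)
Lemma prod_tperm_lo_hi (r : seq 'I_k) a : uniq r ->
  let p := (\prod_(b <- r) tperm (lo b) (hi b))%g in
  p (lo a) = (if a \in r then hi a else lo a)
  /\ p (hi a) = (if a \in r then lo a else hi a).
Proof.
elim: r => [_|b r IH /=/andP[br /IH[]]] /=; first by rewrite big_nil !perm1.
rewrite big_cons !permM inE => {IH} IHl IHh.
have [ab|ab] := eqVneq a b.
  rewrite ab in IHl IHh *; rewrite tpermL tpermR.
  by rewrite IHl IHh (negPf br).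
by rewrite !tpermD // ?(inj_eq lo_inj) ?(inj_eq hi_inj) ?lo_neq_hi // eq_sym
  // lo_neq_hi.
Qed.

Lemma pi_pairs_lo a : pi_pairs k (lo a) = hi a.
Proof. by have [-> _] := prod_tperm_lo_hi a (index_enum_uniq 'I_k); rewrite mem_index_enum. Qed.

Lemma pi_pairs_hi a : pi_pairs k (hi a) = lo a.
Proof. by have [_ ->] := prod_tperm_lo_hi a (index_enum_uniq 'I_k); rewrite mem_index_enum. Qed.

End PairsOfIndices.

(** * The automorphism tau and its orbits *)

Section TwistedSwap.

Variables (F : fieldType) (eta : F).
Hypotheses (F2 : 2%:R != 0 :> F) (eta0 : eta != 0).
Variables (k : nat) (T : finGroupType) (sigma : {perm T}).
Hypothesis T3 : forall t : T, (t ^+ 3 = 1)%g.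
Hypothesis sigmaV : {morph sigma : t / t^-1%g}.
Hypothesis sigmaK : involutive sigma.
Variable pi : 'S_(2 * k).
Hypotheses (pi_lo : forall a : 'I_k, pi (lo a) = hi a)
           (pi_hi : forall a : 'I_k, pi (hi a) = lo a).
Notation D := (wrD T (2 * k)).
Variable tau : {perm point D}.
Hypothesis tauE : forall (c : point D) t i j,
  i != j -> val c = tr t i j -> val (tau c) = tr (sigma t) (pi i) (pi j).
Notation H := <[tau]>%G.
Notation vec := (mvec F D).
Implicit Types (t : T) (i j : 'I_(2 * k)) (a b : 'I_k) (w : matsuo F D).

(** For i != j this is the sum over the orbit of t.(i,j) unless tau fixes that
    point, in which case it is twice the point. *)
Definition tau_sum t i j : matsuo F D :=
  vec (tr t i j) + vec (tr (sigma t) (pi i) (pi j)).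

Definition point_tr t i j (ij : i != j) : point D := Sub (tr t i j) (mem_tr t ij).

Lemma pi_eq i j : (pi i == pi j) = (i == j).
Proof. exact: inj_eq perm_inj _ _. Qed.

Lemma piK : involutive pi.
Proof. by move=> i; have [a [->|->]] := lo_hi_cases i; rewrite ?(pi_lo, pi_hi). Qed.

Lemma pi_neq i : pi i != i.
Proof.
have [a [->|->]] := lo_hi_cases i; rewrite ?pi_lo ?pi_hi ?lo_neq_hi //.
by rewrite eq_sym lo_neq_hi.
Qed.

Lemma tau_involutive : involutive tau.
Proof.
move=> c; apply: val_inj; have /wrDP[t [i [j [ij ct]]]] := valP c.
have ij' : pi i != pi j by rewrite pi_eq.
by rewrite (tauE ij' (tauE ij ct)) sigmaK !piK ct.
Qed.

Lemma tau_sum_swap t i j : i != j -> tau_sum t i j = tau_sum t^-1%g j i.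
Proof.
move=> ij; have pij : pi i != pi j by rewrite pi_eq.
have e := tr_swap (sigma t) pij; rewrite -sigmaV in e.
by rewrite /tau_sum (tr_swap t ij) e.
Qed.

Lemma tau_sum_tau t i j : tau_sum t i j = tau_sum (sigma t) (pi i) (pi j).
Proof.
rewrite /tau_sum sigmaK !piK; exact: addrC.
Qed.

Lemma tr_lo_hi_tau t a :
  tr (sigma t) (pi (lo a)) (pi (hi a)) = tr (sigma t)^-1%g (lo a) (hi a).
Proof. by rewrite pi_lo pi_hi tr_swap // eq_sym lo_neq_hi. Qed.

Lemma tau_sum_lo_hi t a :
  tau_sum t (lo a) (hi a) = tau_sum (sigma t)^-1%g (lo a) (hi a).
Proof.
rewrite tau_sum_tau pi_lo pi_hi; apply: tau_sum_swap.
by rewrite eq_sym lo_neq_hi.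
Qed.

Lemma tr_lo_hi_inj t t' a b :
  tr t (lo a) (hi a) = tr t' (lo b) (hi b) -> t = t' /\ a = b.
Proof.
case/(tr_eq (lo_neq_hi a a) (lo_neq_hi b b)) => -[/eqP ab _ tt].
  by move: ab; rewrite (inj_eq (@lo_inj k)) => /eqP.
by rewrite (negPf (lo_neq_hi _ _)) in ab.
Qed.

Lemma wrD_cases (c : point D) :
  (exists t a, val c = tr t (lo a) (hi a)) \/
  (exists t i j, [/\ i != j, pi i != j & val c = tr t i j]).
Proof.
have /wrDP[t [i [j [ij ->]]]] := valP c.
have [e|ne] := eqVneq (pi i) j; last by right; exists t, i, j.
left; move: ij; rewrite -e; have [a [->|->]] := lo_hi_cases i.
  by exists t, a; rewrite pi_lo.
rewrite pi_hi => hl; exists t^-1%g, a; exact: tr_swap.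
Qed.

Lemma tr_lo_hi_neq t t' i j a : i != j -> pi i != j ->
  tr t i j != tr t' (lo a) (hi a).
Proof.
move=> ij pij; apply/eqP=> /(tr_eq ij (lo_neq_hi a a))[] -[ia ja _];
  by rewrite ia ja ?pi_lo ?pi_hi eqxx in pij.
Qed.

Lemma tr_tau_neq t i j : i != j -> pi i != j ->
  tr t i j != tr (sigma t) (pi i) (pi j).
Proof.
move=> ij pij; apply/eqP=> e.
have pp : pi i != pi j by rewrite pi_eq.
case: (tr_eq ij pp e) => -[ii jj _].
  by have := pi_neq i; rewrite -ii eqxx.
by rewrite -jj eqxx in pij.
Qed.

Lemma single_trP w : @is_single F _ D H w <->
  exists t a, (sigma t)^-1%g = t /\ w = vec (tr t (lo a) (hi a)).
Proof.
split=> [/(is_singleP tau_involutive)[c fc ->]|[t [a [ft ->]]]].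
  have [[t [a ct]]|[t [i [j [ij pij ct]]]]] := wrD_cases c.
    exists t, a; rewrite ct; split=> //.
    have := congr1 val fc; rewrite (tauE (lo_neq_hi a a) ct) tr_lo_hi_tau ct.
    by case/tr_lo_hi_inj.
  have := tr_tau_neq t ij pij; rewrite -ct -(tauE ij ct) fc.
  by rewrite eqxx.
apply/(is_singleP tau_involutive); pose c := point_tr t (lo_neq_hi a a).
exists c => //; apply: val_inj.
by rewrite (tauE (lo_neq_hi a a) (erefl (val c))) tr_lo_hi_tau ft.
Qed.

Lemma mvec_mul_lo_hi t a : (sigma t)^-1%g != t ->
  mvec_mul eta D (tr t (lo a) (hi a)) (tr (sigma t) (pi (lo a)) (pi (hi a))) != 0.
Proof.
move=> ft; have lh := lo_neq_hi a a; rewrite tr_lo_hi_tau.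
have := @mvec_mul_neq0 F eta _ D (point_tr t lh) (tr (sigma t)^-1%g (lo a) (hi a)).
apply=> //=; try exact: tr_involution.
by apply: order_tr_mul => //; rewrite eq_sym.
Qed.

Lemma mvec_mul_tau t i j : i != j -> pi i != j ->
  mvec_mul eta D (tr t i j) (tr (sigma t) (pi i) (pi j)) = 0.
Proof.
move=> ij pij; apply: mvec_mul_eq0; first exact: tr_tau_neq.
have ipj : i != pi j by rewrite -(pi_eq i) piK.
by apply: order_tr_disjoint; rewrite ?pi_eq // eq_sym // pi_neq.
Qed.

Lemma double_trP w : @is_double F eta _ D H w <->
  exists t i j, [/\ i != j, pi i != j & w = tau_sum t i j].
Proof.
split=> [/(is_doubleP _ tau_involutive)[c [fc c0 ->]]|[t [i [j [ij pij ->]]]]].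
  have [[t [a ct]]|[t [i [j [ij pij ct]]]]] := wrD_cases c.
    have cE := tauE (lo_neq_hi a a) ct.
    have ft : (sigma t)^-1%g != t.
      apply: contra fc => /eqP ft; apply/eqP/val_inj.
      by rewrite cE tr_lo_hi_tau ft ct.
    by have := mvec_mul_lo_hi a ft; rewrite -cE -ct c0 eqxx.
  by exists t, i, j; rewrite /tau_sum -ct -(tauE ij ct).
apply/(is_doubleP _ tau_involutive); pose c := point_tr t ij.
have cE := tauE ij (erefl (val c)).
exists c; rewrite -val_eqE cE mvec_mul_tau //; split=> //.
by rewrite eq_sym tr_tau_neq.
Qed.

Lemma extra_trP w : @is_extra F eta _ D H w <->
  exists t a, (sigma t)^-1%g <> t /\ w = tau_sum t (lo a) (hi a).
Proof.
split=> [/(is_extraP _ tau_involutive)[c [fc c0 ->]]|[t [a [ft ->]]]].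
  have [[t [a ct]]|[t [i [j [ij pij ct]]]]] := wrD_cases c.
    have cE := tauE (lo_neq_hi a a) ct.
    exists t, a; rewrite /tau_sum -ct -cE; split=> // ft; case/eqP: fc.
    by apply: val_inj; rewrite cE tr_lo_hi_tau ft ct.
  by rewrite ct (tauE ij ct) mvec_mul_tau ?eqxx in c0.
move/eqP in ft.
apply/(is_extraP _ tau_involutive); pose c := point_tr t (lo_neq_hi a a).
have cE := tauE (lo_neq_hi a a) (erefl (val c)).
exists c; rewrite -val_eqE cE mvec_mul_lo_hi //; split=> //.
by rewrite tr_lo_hi_tau; apply: contra ft => /eqP/tr_lo_hi_inj[->].
Qed.

Lemma tau_sum_inj t i j t' i' j' :
    i != j -> tr t i j != tr (sigma t) (pi i) (pi j) ->
    tau_sum t i j = tau_sum t' i' j' ->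
  tr t i j = tr t' i' j' \/ tr t i j = tr (sigma t') (pi i') (pi j').
Proof. by move=> ij; apply: mvec_pair_inj; apply: mem_tr. Qed.

Lemma tau_sum_lo_hi_inj t t' a b : (sigma t)^-1%g <> t ->
    tau_sum t (lo a) (hi a) = tau_sum t' (lo b) (hi b) ->
  a = b /\ (t = t' \/ t = (sigma t')^-1%g).
Proof.
move=> ft /tau_sum_inj[]; rewrite ?lo_neq_hi ?tr_lo_hi_tau //.
- by apply/eqP=> /tr_lo_hi_inj[/esym].
- by case/tr_lo_hi_inj; auto.
by case/tr_lo_hi_inj; auto.
Qed.

(** Two distinct blocks {a, b} carry four unordered pairs of indices with one
    index in each block, which pi groups into two classes: the parallel pairs
    {lo a, lo b}, {hi a, hi b} and the crossed pairs {lo a, hi b}, {hi a, lo b}.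
    There are also two orders of a and b: the one with a < b is used to encode
    the parallel class, the other one to encode the crossed class. *)
Definition partner a b : 'I_(2 * k) := if (a < b)%N then lo b else hi b.

Lemma pi_lo_neq_partner a b : a != b -> pi (lo a) != partner a b.
Proof.
rewrite pi_lo /partner; case: ifP => _ ab; first by rewrite eq_sym lo_neq_hi.
by rewrite (inj_eq (@hi_inj k)).
Qed.

Lemma lo_neq_partner a b : a != b -> lo a != partner a b.
Proof.
rewrite /partner; case: ifP => _ ab; last by rewrite lo_neq_hi.
by rewrite (inj_eq (@lo_inj k)).
Qed.

(** With par and cro dealing with the pairs that start at some lo a, applying
    tau or swapping the indices brings every other pair to one of these. *)
Lemma tau_sum_partner t i j : i != j -> pi i != j ->
  exists t' a b, a != b /\ tau_sum t i j = tau_sum t' (lo a) (partner a b).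
Proof.
have par s a b : a != b -> exists t' a' b', a' != b' /\
    tau_sum s (lo a) (lo b) = tau_sum t' (lo a') (partner a' b').
  rewrite /partner => ab; have [lt|gt|e] := ltngtP a b.
  - by exists s, a, b; rewrite lt.
  - exists s^-1%g, b, a; rewrite gt; split; first by rewrite eq_sym.
    by apply: tau_sum_swap; rewrite (inj_eq (@lo_inj k)).
  by rewrite (val_inj e) eqxx in ab.
have cro s a b : a != b -> exists t' a' b', a' != b' /\
    tau_sum s (lo a) (hi b) = tau_sum t' (lo a') (partner a' b').
  rewrite /partner => ab; have [lt|gt|e] := ltngtP a b.
  - exists (sigma s)^-1%g, b, a; rewrite ltnNge (ltnW lt).
    split; first by rewrite eq_sym.
    rewrite tau_sum_tau pi_lo pi_hi; apply: tau_sum_swap.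
    by rewrite eq_sym lo_neq_hi.
  - by exists s, a, b; rewrite ltnNge (ltnW gt).
  by rewrite (val_inj e) eqxx in ab.
have [a [->|->]] := lo_hi_cases i; have [b [->|->]] := lo_hi_cases j;
  rewrite ?pi_lo ?pi_hi ?(inj_eq (@lo_inj k)) ?(inj_eq (@hi_inj k)).
- by move=> ab _; apply: par.
- by move=> _ ab; apply: cro.
- by move=> ij ab; rewrite (tau_sum_swap t ij); apply: cro; rewrite eq_sym.
by move=> ab _; rewrite tau_sum_tau !pi_hi; apply: par.
Qed.

(** Any other coincidence of the points would match lo with hi, or exchange the
    two blocks and so contradict their order. *)
Lemma tau_sum_partner_inj t t' a b a' b' : a != b -> a' != b' ->
    tau_sum t (lo a) (partner a b) = tau_sum t' (lo a') (partner a' b') ->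
  [/\ t = t', a = a' & b = b'].
Proof.
move=> ab ab'.
have [lp lp'] := (lo_neq_partner ab, lo_neq_partner ab').
have plp' : pi (lo a') != pi (partner a' b') by rewrite pi_eq.
have lh x y : lo x = hi y :> 'I_(2 * k) -> False by move/eqP; rewrite (negPf (lo_neq_hi x y)).
case/tau_sum_inj=> //; first exact/tr_tau_neq/pi_lo_neq_partner.
  case/tr_eq => // -[].
    move=> /lo_inj <- + ->; rewrite /partner.
    by case: ifP => _; case: ifP => _; [move/lo_inj | move/lh | move/esym/lh | move/hi_inj] => // ->.
  rewrite /partner; case: ifP => lt'; last by move/lh.
  case: ifP => lt; last by move=> _ /esym/lh.
  by move=> /lo_inj e /lo_inj e' _; rewrite e e' ltnNge (ltnW lt') in lt.
case/tr_eq => //; rewrite pi_lo /partner => -[]; first by move/lh.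
case: (ltnP a' b') => lt'; rewrite ?pi_lo ?pi_hi; first by move/lh.
case: (ltnP a b) => lt; first by move=> _ /lh.
move=> /lo_inj e /hi_inj e'; case/eqP: ab; rewrite e e' in lt *.
by apply/val_inj/eqP; rewrite eqn_leq lt lt'.
Qed.

Lemma has_card_double :
  has_card (@is_double F eta _ D H) (#|T| * (k * k.-1)).
Proof.
have -> : (#|T| * (k * k.-1))%N = #|{: T * ('I_k * 'I_k.-1)}|.
  by rewrite !card_prod !card_ord.
apply: (@has_card_image _ _ (fun x => tau_sum x.1 (lo x.2.1)
                                     (partner x.2.1 (lift x.2.1 x.2.2)))).
  move=> [t [a b]] [t' [a' b']] /= /tau_sum_partner_inj[]; rewrite ?neq_lift //.
  by move=> -> <- /lift_inj ->.
move=> w; split=> [/double_trP[t [i [j [ij pij ->]]]]|[[t [a b]] /= ->]].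
  have [t' [a [b [ab ->]]]] := tau_sum_partner t ij pij.
  by have [b' -> _] := unlift_some ab; exists (t', (a, b')).
apply/double_trP; exists t, (lo a), (partner a (lift a b)).
by rewrite lo_neq_partner ?pi_lo_neq_partner ?neq_lift.
Qed.

Lemma dim_fixed_count m p :
    has_card (@is_single F _ D H) m -> has_card (@is_extra F eta _ D H) p ->
  \dim (matsuo_fixed F H) = (m + (#|T| * (k * k.-1) + p))%N.
Proof.
move=> hs he; rewrite dim_matsuo_fixed.
apply: has_card_inj (has_card_orbit_vectors F H) _.
apply: (@eq_has_card _ (predU (@is_single F _ D H)
         (predU (@is_double F eta _ D H) (@is_extra F eta _ D H)))).
  by move=> w; rewrite /= (orbit_vectors_cases eta tau_involutive).
apply: has_card_predU => //; first apply: has_card_predU => //.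
- exact: has_card_double.
- move=> w /double_trP[t [i [j [ij pij ->]]]] /extra_trP[s [a [_ e]]].
  case/(tau_sum_inj ij (tr_tau_neq t ij pij)): e; apply/eqP.
    exact: tr_lo_hi_neq.
  by rewrite tr_lo_hi_tau tr_lo_hi_neq.
move=> w /single_trP[s [a [_ ->]]] /orP[].
  case/double_trP=> t [i [j [ij pij /esym/eqP]]]; apply/negP.
  apply: mvec_neq_pair; rewrite ?mem_tr ?pi_eq //.
  exact: tr_tau_neq.
case/extra_trP=> t [b [/eqP ft /esym/eqP]]; apply/negP.
apply: mvec_neq_pair; rewrite ?mem_tr ?pi_eq ?lo_neq_hi //.
by rewrite tr_lo_hi_tau; apply: contra ft => /eqP/tr_lo_hi_inj[<-].
Qed.

End TwistedSwap.

(** * The elementary abelian group of order 9 *)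

Section ElementaryNine.

Variables (P : finGroupType) (u v : P).
Hypothesis hPabelem : 3.-abelem [set: P].
Hypothesis hPcard : #|[set: P]| = 9%N.
Hypothesis hPgen : <<[set u; v]>>%g = [set: P].

Lemma abelem_cube (t : P) : (t ^+ 3 = 1)%g.
Proof. by have /and3P[_ _ /exponentP->] := hPabelem; rewrite ?inE. Qed.

Lemma abelem_commute (s t : P) : commute s t.
Proof. by apply: (centsP (abelem_abelian hPabelem)); rewrite inE. Qed.

Lemma expg_mod3 (t : P) m : (t ^+ (m %% 3) = t ^+ m)%g.
Proof. exact: expg_mod (abelem_cube t). Qed.

Lemma exponents_surj (t : P) : exists r s : 'I_3, t = (u ^+ r * v ^+ s)%g.
Proof.
have : t \in <[u]> <*> <[v]>.
  by rewrite joing_idl joing_idr /joing hPgen inE.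
rewrite cent_joinEr; last first.
  by apply/centsP=> x _ y _; apply: abelem_commute.
case/mulsgP=> _ _ /cycleP[m ->] /cycleP[p ->] ->.
exists (Ordinal (ltn_pmod m (isT : 0 < 3)%N)), (Ordinal (ltn_pmod p (isT : 0 < 3)%N)).
by rewrite /= !expg_mod3.
Qed.

(** The nine pairs of exponents modulo 3 reach all nine elements, so no two of
    them give the same element. *)
Lemma exponents_inj (r s r' s' : nat) :
    (u ^+ r * v ^+ s = u ^+ r' * v ^+ s')%g ->
  r = r' %[mod 3] /\ s = s' %[mod 3].
Proof.
pose f (x : 'I_3 * 'I_3) : P := (u ^+ x.1 * v ^+ x.2)%g.
have f_inj : injective f.
  suff: {in predT &, injective f} by move=> fi x y; apply: fi.
  apply/imset_injP; rewrite card_prod !card_ord -[(3 * 3)%N]/9%N -hPcard.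
  apply/eqP/eq_card => t.
  have [a [b ->]] := exponents_surj t; rewrite inE; apply/imsetP.
  by exists (a, b).
pose m n : 'I_3 := Ordinal (ltn_pmod n (isT : 0 < 3)%N).
have fm a b : f (m a, m b) = (u ^+ a * v ^+ b)%g by rewrite /f /= !expg_mod3.
by rewrite -!fm => /f_inj[].
Qed.

Variable sigma : {perm P}.
Hypothesis hsigma : sigma \in Aut [set: P].
Hypotheses (hsigma_u : sigma u = v) (hsigma_v : sigma v = u).

Lemma AutM s t : sigma (s * t)%g = (sigma s * sigma t)%g.
Proof. by have /morphicP -> := Aut_morphic hsigma; rewrite ?inE. Qed.

Lemma AutV : {morph sigma : t / t^-1%g}.
Proof.
have s1 : sigma 1%g = 1%g by apply: (mulgI (sigma 1%g)); rewrite -AutM !mulg1.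
by move=> t; apply: (mulgI (sigma t)); rewrite -AutM !mulgV.
Qed.

Lemma AutX t n : sigma (t ^+ n)%g = (sigma t ^+ n)%g.
Proof.
elim: n => [|n IH]; last by rewrite !expgS AutM IH.
by rewrite !expg0; apply: (mulgI (sigma 1%g)); rewrite -AutM !mulg1.
Qed.

Lemma swap_exponents r s : sigma (u ^+ r * v ^+ s)%g = (u ^+ s * v ^+ r)%g.
Proof. by rewrite AutM !AutX hsigma_u hsigma_v; apply/commuteX2/abelem_commute. Qed.

Lemma swap_involutive : involutive sigma.
Proof. by move=> t; have [r [s ->]] := exponents_surj t; rewrite !swap_exponents. Qed.

Lemma swapV_exponents r s :
  (sigma (u ^+ r * v ^+ s))^-1%g = (u ^+ (2 * s) * v ^+ (2 * r))%g.
Proof.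
have V t n : (t ^+ n)^-1%g = (t ^+ (2 * n))%g :> P.
  apply: (mulgI (t ^+ n)%g); rewrite mulgV -expgD -[(n + _)%N]/(3 * n)%N.
  by rewrite expgM abelem_cube expg1n.
rewrite swap_exponents invMg !V; exact/commuteX2/abelem_commute.
Qed.

Lemma swapV_fixed r s :
  (sigma (u ^+ r * v ^+ s))^-1%g = (u ^+ r * v ^+ s)%g <-> r + s = 0 %[mod 3].
Proof.
rewrite swapV_exponents; split=> [/exponents_inj[]|rs]; first by lia.
by congr (_ * _)%g; rewrite -expg_mod3 -[RHS]expg_mod3; congr (_ ^+ _)%g; lia.
Qed.

(** The elements u^r v^s with r + s = n modulo 3. The subtraction is truncated,
    so weight 0 is written n = 3 and weight 1 is written n = 4. *)
Definition weight_elt n (r : 'I_3) : P := (u ^+ r * v ^+ (n - r))%g.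

Lemma weight_eltE n (r s : nat) (lt : (r %% 3 < 3)%N) : (3 <= n)%N ->
  r + s = n %[mod 3] -> (u ^+ r * v ^+ s)%g = weight_elt n (Ordinal lt).
Proof.
move=> n3 rs; rewrite /weight_elt /= expg_mod3 -(expg_mod3 v s).
rewrite -(expg_mod3 v (n - _)); congr (_ * _ ^+ _)%g.
by clear -n3 rs lt; lia.
Qed.

Lemma weight_elt_inj n : injective (weight_elt n).
Proof.
by move=> r r' /exponents_inj[+ _]; rewrite !modn_small // => /val_inj.
Qed.

Lemma swapV_fixedP t :
  (sigma t)^-1%g = t <-> exists r, t = weight_elt 3 r.
Proof.
split=> [|[r ->]]; last first.
  by apply/swapV_fixed; have := ltn_ord r; clear; lia.
have [r [s ->]] := exponents_surj t => /swapV_fixed rs.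
by eexists; apply: (weight_eltE (ltn_pmod r (isT : 0 < 3)%N)).
Qed.

Lemma swapV_weight1 r : (sigma (weight_elt 4 r))^-1%g <> weight_elt 4 r.
Proof. by move/swapV_fixed; have := ltn_ord r; clear; lia. Qed.

(** The map t |-> (sigma t)^-1 sends weight 1 to weight 2, so an element of
    weight 1 is never the image of another one. *)
Lemma swapV_weight1_neq r r' : weight_elt 4 r <> (sigma (weight_elt 4 r'))^-1%g.
Proof.
rewrite swapV_exponents => /exponents_inj[].
by have := ltn_ord r; have := ltn_ord r'; clear; lia.
Qed.

(** An orbit {t, (sigma t)^-1} of length 2 contains one element of weight 1 and
    one of weight 2; the first serves as its representative. *)
Lemma swapV_movedP t : (sigma t)^-1%g <> t ->
  exists r, t = weight_elt 4 r \/ (sigma t)^-1%g = weight_elt 4 r.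
Proof.
have [r [s ->]] := exponents_surj t => fx.
have rs : r + s <> 0 %[mod 3] by move/swapV_fixed.
have lt := ltn_pmod _ (isT : 0 < 3)%N.
have [rs1|rs2] : r + s = 4 %[mod 3] \/ 2 * s + 2 * r = 4 %[mod 3].
- by clear -rs; lia.
- by eexists; left; apply: (weight_eltE (lt r)).
by rewrite swapV_exponents; eexists; right; apply: (weight_eltE (lt (2 * s)%N)).
Qed.

End ElementaryNine.

Theorem proposition3p16
  (F : fieldType) (eta : F)
  (hF : 2%:R != 0 :> F) (heta0 : eta != 0) (heta1 : eta != 1)
  (k : nat) (hk : (1 <= k)%N)
  (P : finGroupType) (u v : P)
  (hPabelem : 3.-abelem [set: P]) (hPcard : #|[set: P]| = 9%N)
  (hPgen : <<[set u; v]>>%g = [set: P])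
  (sigma : {perm P}) (hsigma : sigma \in Aut [set: P])
  (hsigma_u : sigma u = v) (hsigma_v : sigma v = u)
  (tau : {perm point (wrD P (2 * k))})
  (htau : tau \in fischer_aut (wrD P (2 * k)))
  (htauE : forall (c : point (wrD P (2 * k))) (t : P) (i j : 'I_(2 * k)),
     i != j -> val c = tr t i j ->
     val (tau c) = tr (sigma t) (pi_pairs k i) (pi_pairs k j)) :
  let D := wrD P (2 * k) in
  let pi := pi_pairs k in
  let H := <[tau]>%G in
  let vec (x : wr P (2 * k)) : matsuo F D := mvec F D x in
  let single := @is_single F _ D H in
  let double := @is_double F eta _ D H in
  let extra := @is_extra F eta _ D H in
  [/\ \dim (matsuo_fixed F H) = (9 * k ^ 2 - 3 * k)%N,
      has_card single (3 * k)%N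
      /\ (forall w : matsuo F D, single w <->
           exists (r s : 'I_3) (i : 'I_k),
             (r + s = 0 %[mod 3])%N /\
             w = vec (tr (u ^+ r * v ^+ s)%g (lo i) (hi i))),
      has_card double (9 * k * (k - 1))%N
      /\ (forall w : matsuo F D, double w <->
           exists (t : P) (i j : 'I_(2 * k)),
             [/\ i != j, pi i != j &
              w = vec (tr t i j) + vec (tr (sigma t) (pi i) (pi j))])
    & has_card extra (3 * k)%N
      /\ (forall w : matsuo F D, extra w <->
           exists (r s : 'I_3) (i : 'I_k),
             (r + s <> 0 %[mod 3])%N /\
             w = vec (tr (u ^+ r * v ^+ s)%g (lo i) (hi i))
               + vec (tr (u ^+ (2 * s)%N * v ^+ (2 * r)%N)%g (lo i) (hi i)))].
Proof.
move=> D pi H vec single double extra.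
have P3 := abelem_cube hPabelem.
have sV := AutV hsigma.
have sK := swap_involutive hPabelem hPgen hsigma hsigma_u hsigma_v.
have expS := exponents_surj hPabelem hPgen.
have expI := exponents_inj hPabelem hPcard hPgen.
have fixP := swapV_fixedP hPabelem hPcard hPgen hsigma hsigma_u hsigma_v.
have fixE := swapV_fixed hPabelem hPcard hPgen hsigma hsigma_u hsigma_v.
have sVE := swapV_exponents hPabelem hsigma hsigma_u hsigma_v.
have pl := @pi_pairs_lo k; have ph := @pi_pairs_hi k.
have singleE (w : matsuo F D) := single_trP sK pl ph htauE w.
have doubleE (w : matsuo F D) := double_trP hF heta0 P3 sK pl ph htauE w.
have extraE (w : matsuo F D) := extra_trP hF heta0 P3 sK pl ph htauE w.
have lhE t a := tr_lo_hi_tau sigma pl ph t a.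
have card_single : has_card single (3 * k).
  have <- : #|{: 'I_3 * 'I_k}| = (3 * k)%N by rewrite card_prod !card_ord.
  apply: (@has_card_image _ _ (fun x : 'I_3 * 'I_k =>
    vec (tr (weight_elt u v 3 x.1) (lo x.2) (hi x.2)))).
    move=> [r a] [r' a'] /= /mvec_inj; rewrite mem_tr ?lo_neq_hi // => /(_ isT).
    by case/tr_lo_hi_inj=> /(weight_elt_inj hPabelem hPcard hPgen) <- <-.
  move=> w; split=> [/singleE[t [a [/fixP[r ->] ->]]]|[[r a] /= ->]].
    by exists (r, a).
  by apply/singleE; exists (weight_elt u v 3 r), a; split=> //; apply/fixP; exists r.
have card_extra : has_card extra (3 * k).
  have <- : #|{: 'I_3 * 'I_k}| = (3 * k)%N by rewrite card_prod !card_ord.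
  have nfix := swapV_weight1 hPabelem hPcard hPgen hsigma hsigma_u hsigma_v.
  apply: (@has_card_image _ _ (fun x : 'I_3 * 'I_k =>
    tau_sum F sigma pi (weight_elt u v 4 x.1) (lo x.2) (hi x.2))).
    move=> [r a] [r' a'] /= /(tau_sum_lo_hi_inj pl ph (nfix r))[<-].
    case=> [/(weight_elt_inj hPabelem hPcard hPgen) <- //|].
    by move/(swapV_weight1_neq hPabelem hPcard hPgen hsigma hsigma_u hsigma_v).
  move=> w; split=> [/extraE[x [a [fx ->]]]|[[r a] /= ->]]; last first.
    by apply/extraE; exists (weight_elt u v 4 r), a; split; first exact: nfix.
  have [r xr] := swapV_movedP hPabelem hPcard hPgen hsigma hsigma_u hsigma_v fx.
  exists (r, a); case: xr => [->//|<-]; exact: tau_sum_lo_hi.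
split.
- have := dim_fixed_count hF heta0 P3 sV sK pl ph htauE
    card_single card_extra.
  move=> ->; rewrite -cardsT hPcard; by clear -hk; nia.
- split; first exact: card_single.
  move=> w; split=> [/singleE[t [a [ft ->]]]|[r [s [a [rs ->]]]]].
    have [r [s tE]] := expS t; rewrite tE; exists r, s, a; split=> //.
    by apply/fixE; rewrite -tE.
  by apply/singleE; exists (u ^+ r * v ^+ s)%g, a; split=> //; apply/fixE.
- split; last exact: doubleE.
  have card_double := has_card_double hF heta0 P3 sV sK pl ph htauE.
  rewrite -cardsT hPcard mulnA -subn1 in card_double; exact: card_double.
split; first exact: card_extra.
move=> w; split=> [/extraE[t [a [ft ->]]]|[r [s [a [rs ->]]]]].
  have [r [s tE]] := expS t; exists r, s, a; split.
    by move/fixE; rewrite -tE.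
  by rewrite -sVE -tE -lhE.
apply/extraE; exists (u ^+ r * v ^+ s)%g, a; split; first by move/fixE.
by rewrite -sVE -lhE.
Qed.
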